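(* Let $0<q<1$ and let $n,s\ge 0$ be integers. Then \[ \frac{1}{q^{\binom{s}{2}}[s]_q!\,c(q)}\int_{-\nu}^{\nu}x^{2n}H_s(x,q)^2\,w_G(x)\,d_qx=\sum_{\mu\in Y(n,s)}\prod_{i=1}^n q^{\mu_i-i}[\mu_i-i+1]_q, \] where \[ \nu=\frac{1}{\sqrt{1-q}}\qquad\text{and}\qquad c(q)=2(1-q)^{\frac12}\sum_{m=0}^{\infty}\frac{(-1)^m q^{m(m+1)}}{(1-q^{2m+1})\prod_{i=0}^{m-1}(1-q^{2i+2})}. \]
   Context: For an integer $m$, $[m]_q=\frac{1-q^m}{1-q}$, and for $m\ge0$, $[m]_q!=\prod_{i=1}^m[i]_q$. The $q$-Hermite polynomials $H_n(x,q)$ are defined by $H_0=1$, $H_1=x$, and $H_{n+1}(x,q)=xH_n(x,q)-q^{n-1}[n]_qH_{n-1}(x,q)$ for $n\ge1$. The Gaussian $q$-distribution is $w_G(x)=E_{q^2}^{-q^2x^2/[2]_q}$, where $E_q^x=\sum_{m=0}^\infty q^{\binom m2}\frac{x^m}{[m]_q!}$ (and $E_{q^2}$ is obtained by replacing $q$ by $q^2$); explicitly, $w_G(x)=\sum_{m=0}^{\infty}\frac{q^{m(m+1)}(q-1)^m}{\prod_{i=0}^{m-1}(1-q^{2i+2})}x^{2m}$. The Jackson $q$-integral is $\int_0^b f(x)\,d_qx=(1-q)\,b\sum_{m=0}^\infty q^m f(q^m b)$ and $\int_a^b f\,d_qx=\int_0^b f\,d_qx-\int_0^a f\,d_qx$.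 $Y(n,s)$ is the set of integer sequences $\mu=(\mu_1,\ldots,\mu_n)$ with $s\le\mu_1\le\mu_2\le\cdots\le\mu_n\le n+s$. *)

(* Defs.v *)
From HB Require Import structures.
From mathcomp Require Import all_boot all_order all_algebra.
From mathcomp Require Import all_classical all_reals all_analysis.

Set Implicit Arguments.
Unset Strict Implicit.
Unset Printing Implicit Defensive.

Import Order.TTheory GRing.Theory Num.Theory numFieldNormedType.Exports.

Local Open Scope ring_scope.

Section QCalculus.
Variable R : realType.
Implicit Types (q a b x : R) (f : R -> R).

Definition qint q (m : int) : R := (1 - q ^ m) / (1 - q).

Definition qfact q (m : nat) : R := \prod_(1 <= i < m.+1) qint q i%:Z.

(* E_q^x, the q-exponential carrying the factor q ^ 'C(m, 2). *)
Definition qExp q x : R :=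
  limn (series (fun m : nat => q ^+ 'C(m, 2) * (x ^+ m / qfact q m))).

Definition wG q x : R :=
  qExp (q ^+ 2) (- (q ^+ 2 * x ^+ 2 / qint q 2%:Z)).

(* The recurrence at index n = k + 1, so that q ^ (n - 1) = q ^+ k. *)
Fixpoint qHermite q (n : nat) : {poly R} :=
  match n with
  | 0 => 1
  | m.+1 =>
    match m with
    | 0 => 'X
    | k.+1 => 'X * qHermite q m - (q ^+ k * qint q m%:Z) *: qHermite q k
    end
  end.

Definition jackson0 q f b : R :=
  (1 - q) * b * limn (series (fun m : nat => q ^+ m * f (q ^+ m * b))).

Definition jackson q f a b : R := jackson0 q f b - jackson0 q f a.

Definition nu q : R := 1 / Num.sqrt (1 - q).

Definition cG q : R :=
  2 * Num.sqrt (1 - q) *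
  limn (series (fun m : nat =>
    ((-1) ^+ m * q ^+ (m * m.+1)) /
    ((1 - q ^+ (2 * m + 1)) * \prod_(0 <= i < m) (1 - q ^+ (2 * i + 2))))).

End QCalculus.

(* The entries are taken in 'I_(n + s).+1, which encodes the upper bound n + s;
   mu_1, ..., mu_n are the values of mu at the ordinals 0, ..., n - 1. *)
Definition Yset (n s : nat) : {set {ffun 'I_n -> 'I_(n + s).+1}} :=
  [set mu : {ffun 'I_n -> 'I_(n + s).+1} |
    [forall i : 'I_n, (s <= mu i)%N] &&
    [forall i : 'I_n, forall j : 'I_n, (i <= j)%N ==> (mu i <= mu j)%N]].

(* Main.v *)
Require Import Defs.
From HB Require Import structures.
From mathcomp Require Import all_boot all_order all_algebra.
From mathcomp Require Import all_classical all_reals all_analysis.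
From mathcomp Require Import ring lra zify.

(* Write M(p) for the Jackson integral of p w_G over [-nu, nu].  The weight
   satisfies w(x/q) = (1 - (1-q) x^2) w(x), so it vanishes at nu/q and telescoping
   (q-integration by parts) gives M(x p) = M(D_q p).  Since D_q H_(n+1) = [n+1] H_n,
   the recurrence yields M(H_(n+1)) = [n] (1 - q^(n-1)) M(H_(n-1)), whence
   M(H_n) = 0 for n > 0.  The three-term recurrence then gives orthogonality with
   M(H_s^2) = M(1) prod_(i <= s) lambda_i, lambda_i = q^(i-1) [i], and expands
   M(x^(2n) H_s^2) as a sum over up-down paths of length 2n from height s to
   itself, a down step from height h weighing lambda_h; mu_i - i + 1 is the height
   from which the i-th down step starts.  Finally M(1) = c(q) > 0, by integrating
   the power series of w_G termwise. *)

Set Implicit Arguments.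
Unset Strict Implicit.
Unset Printing Implicit Defensive.

Import Order.TTheory GRing.Theory Num.Theory numFieldNormedType.Exports.

Local Open Scope ring_scope.

(* Sum of [prod_i g (off + i) mu_i] over [lo <= mu_0 <= ... <= mu_(d-1) <= N]. *)
Fixpoint monotone_sum (R : pzSemiRingType) (g : nat -> nat -> R)
    (N d lo off : nat) : R :=
  if d is d'.+1 then
    \sum_(lo <= x < N.+1) g off x * monotone_sum g N d' x off.+1
  else 1.

(** * q-Hermite polynomials and their moments under an abstract functional *)

Section QHermite.
Variables (R : realType) (q : R).

(** The recurrence coefficient lambda_n. At [n = 0] the truncated [n.-1] is harmless, since [0]_q =
    0; thus no path steps below height 0. *)
Definition qweight (n : nat) : R := q ^+ n.-1 * qint q n%:Z.

Lemma qint0 : qint q 0 = 0.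
Proof. by rewrite /qint expr0z subrr mul0r. Qed.

Lemma qweight0 : qweight 0 = 0.
Proof. by rewrite /qweight qint0 mulr0. Qed.

Lemma qHermiteSS (n : nat) :
  qHermite q n.+2 = 'X * qHermite q n.+1 - qweight n.+1 *: qHermite q n.
Proof. by []. Qed.

Lemma horner_qHermiteSS (n : nat) (x : R) :
  (qHermite q n.+2).[x] =
  x * (qHermite q n.+1).[x] - qweight n.+1 * (qHermite q n).[x].
Proof. by rewrite qHermiteSS hornerD hornerN hornerM hornerZ hornerX. Qed.

Lemma mulX_qHermite (n : nat) :
  'X * qHermite q n = qHermite q n.+1 + qweight n *: qHermite q n.-1.
Proof.
case: n => [|n] /=; first by rewrite qweight0 scale0r addr0 mulr1.
by rewrite subrK.
Qed.

Hypothesis q_neq1 : q != 1.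

(** D_q H_(n+1) = [n+1] H_n, cleared of denominators. Expand the recurrence at [x] and at [q * x],
    then eliminate the values at [q * x] by the two previous cases. *)
Lemma qHermite_qdiff (n : nat) (x : R) :
  (qHermite q n.+1).[x] - (qHermite q n.+1).[q * x] =
  (1 - q ^+ n.+1) * x * (qHermite q n).[x].
Proof.
have q1 : 1 - q != 0 by rewrite subr_eq0 eq_sym.
elim/ltn_ind: n => -[|[|n]] IH; first by rewrite /= !hornerE; ring.
  rewrite /= !(hornerD, hornerN, hornerM, hornerZ, hornerX, hornerC) /qint /=.
  by rewrite -exprnP; field.
have E2 := IH n.+1 (leqnn _); have E1 := IH n (leqW (leqnn _)).
rewrite (horner_qHermiteSS n.+1 x) (horner_qHermiteSS n.+1 (q * x)).
have -> : (qHermite q n.+2).[q * x] =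
    (qHermite q n.+2).[x] - (1 - q ^+ n.+2) * x * (qHermite q n.+1).[x].
  by rewrite -E2; ring.
have -> : (qHermite q n.+1).[q * x] =
    (qHermite q n.+1).[x] - (1 - q ^+ n.+1) * x * (qHermite q n).[x].
  by rewrite -E1; ring.
rewrite horner_qHermiteSS /qweight /qint /= -!exprnP !exprS; field; exact: q1.
Qed.

Arguments qHermite : simpl never.

Variable M : {scalar {poly R}}.
(** q-integration by parts: [r] is D_q p, specified without dividing by [x]. *)
Hypothesis M_qdiff : forall p r : {poly R},
  (forall x, p.[x] - p.[q * x] = (1 - q) * x * r.[x]) -> M ('X * p) = M r.

Lemma moment_qHermite (n : nat) : M (qHermite q n.+1) = 0.
Proof.
have q1 : 1 - q != 0 by rewrite subr_eq0 eq_sym.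
elim/ltn_ind: n => -[|n] IH.
  rewrite -[qHermite q 1]/('X : {poly R}) -['X]mulr1.
  rewrite (M_qdiff (r := 0)) ?linear0 // => x.
  by rewrite !hornerC mulr0 subrr.
have step : M ('X * qHermite q n.+1) = qint q n.+1 * M (qHermite q n).
  rewrite -linearZ; apply: M_qdiff => x; rewrite qHermite_qdiff hornerZ /qint.
  by rewrite -exprnP; field.
rewrite qHermiteSS linearB linearZ /= step.
(* What remains is [n+1] (1 - q^n) M(H_n): the factor vanishes at [n = 0], and induction applies
   otherwise. *)
case: n IH {step} => [|n] IH; last by rewrite (IH n) // !mulr0 subrr.
by rewrite /qweight expr0 mul1r subrr.
Qed.

Definition qweight_prod (n : nat) : R := \prod_(1 <= i < n.+1) qweight i.

Lemma qweight_prodS (n : nat) :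
  qweight_prod n.+1 = qweight_prod n * qweight n.+1.
Proof. by rewrite /qweight_prod big_nat_recr. Qed.

(** Expanding M(X H_i H_j) against either factor gives [shift], which moves one degree from the
    second index to the first; induction on [b] ends at M(H_a). *)
Lemma moment_qHermite_mul (a b : nat) :
  M (qHermite q a * qHermite q b) = (a == b)%:R * qweight_prod a * M 1.
Proof.
have shift (i j : nat) :
    M (qHermite q i * qHermite q j.+1) +
      qweight j * M (qHermite q i * qHermite q j.-1) =
    M (qHermite q i.+1 * qHermite q j) +
      qweight i * M (qHermite q i.-1 * qHermite q j).
  rewrite -!linearZ -!linearD; congr (M _).
  by rewrite scalerAr scalerAl -mulrDr -mulrDl -!mulX_qHermite mulrCA mulrA.
elim/ltn_ind: b a => -[|b] IH a.
  rewrite mulr1; case: a => [|a]; last by rewrite moment_qHermite !mul0r.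
  by rewrite /qweight_prod big_geq // !mul1r.
apply: (addIr (qweight b * M (qHermite q a * qHermite q b.-1))); rewrite shift.
have IHb := IH b (leqnn _).
have -> : qweight b * M (qHermite q a * qHermite q b.-1) =
    (a.+1 == b)%:R * qweight_prod b * M 1.
  case: b {shift IHb} IH => [|b] IH; first by rewrite qweight0 !mul0r.
  rewrite IH //= eqSS; case: eqP => [->|_]; last by rewrite !mul0r mulr0.
  by rewrite qweight_prodS; ring.
rewrite !IHb; case: a => [|a] /=.
  rewrite qweight0 !mul0r addr0 add0r.
  by case: eqP => [<-|_]; rewrite ?mul0r.
have -> : (a.+1 == b.+1) = (a == b) by [].
rewrite (qweight_prodS a); case: (a.+2 =P b) => [<-|_]; rewrite ?mul0r.
  by rewrite ltn_eqF //; ring.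
by set e := (a == b)%:R; ring.
Qed.

(** Each factor ['X] raises the index of H_b by at most one, so H_a is out of reach and
    orthogonality applies. *)
Lemma moment_eq0 (k a b : nat) : (b + k < a)%N ->
  M ('X^k * (qHermite q a * qHermite q b)) = 0.
Proof.
elim: k b => [|k IH] b ltba.
  by rewrite mul1r moment_qHermite_mul gtn_eqF ?mul0r //; lia.
have -> : 'X^(k.+1) * (qHermite q a * qHermite q b) =
    'X^k * (qHermite q a * qHermite q b.+1) +
    qweight b *: ('X^k * (qHermite q a * qHermite q b.-1)).
  rewrite !scalerAr -!mulrDr -mulX_qHermite exprS; ring.
by rewrite linearD linearZ /= !IH ?mulr0 ?addr0 //; lia.
Qed.

(** The first step of a path from height [a]: up with weight 1, or down with weight lambda_a. *)
Lemma moment_mulXn (k a b : nat) :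
  M ('X^(k.+1) * (qHermite q a * qHermite q b)) =
  M ('X^k * (qHermite q a.+1 * qHermite q b)) +
  qweight a * M ('X^k * (qHermite q a.-1 * qHermite q b)).
Proof.
rewrite -linearZ -linearD; congr (M _).
rewrite scalerAr scalerAl -!mulrDr -mulrDl -mulX_qHermite exprS; ring.
Qed.

Variable g : nat -> nat -> R.
Hypothesis gE : forall i x : nat, (i <= x)%N -> g i x = qweight (x - i).

(* [off] down steps have been made so far and [N - lo = u] up steps remain, so
   the current height is [lo - off]; an up step increments [lo], a down step
   increments [off]. *)
Lemma moment_dyck (N u d lo off b : nat) :
  (off <= lo)%N -> (lo + u)%N = N -> (b + off + d)%N = N ->
  M ('X^(u + d) * (qHermite q (lo - off) * qHermite q b)) =
  monotone_sum g N d lo off * (qweight_prod b * M 1).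
Proof.
elim: d lo off u => [|d IHd] lo off u.
  elim: u lo => [|u IHu] lo le_off luN bN.
    rewrite mul1r mul1r moment_qHermite_mul.
    have -> : (lo - off)%N = b by lia.
    by rewrite eqxx mul1r.
  rewrite addSn moment_mulXn -subSn // IHu //; [|lia..].
  (* The [u.+1] steps left are just enough to climb to [b]; after a down step the target is out of
     reach. *)
  rewrite [X in qweight _ * X](_ : _ = 0) ?mulr0 ?addr0 //.
  rewrite [_ * qHermite q b]mulrC moment_eq0 //; lia.
elim: u lo => [|u IHu] lo le_off luN bN.
  (* Every remaining step must go down; an up step would leave the path too high to return to
     [b]. *)
  rewrite add0n moment_mulXn moment_eq0; last by lia.
  rewrite add0r /= (_ : lo = N); last by lia.
  rewrite big_nat1 gE; last by lia.
  case: (ltngtP off N) => [ltoN| |->]; [|lia|by rewrite subnn qweight0 !mul0r].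
  by rewrite -mulrA -(IHd N off.+1 0%N) ?add0n ?subnS //; lia.
rewrite addSn moment_mulXn -subSn // IHu //; [|lia..].
(* The term [x = lo] is an immediate down step; the terms with [x > lo] are the paths that first go
   up. *)
rewrite [in RHS]/= big_ltn; last by lia.
rewrite mulrDl addrC; congr (_ + _).
rewrite gE //; case: (ltngtP off lo) le_off => [ltol _| |-> _]; [|lia|].
  by rewrite -mulrA -(IHd lo off.+1 u.+1) ?subnS ?addSnnS //; lia.
by rewrite subnn qweight0 !mul0r.
Qed.

End QHermite.

(** * Sums over monotone sequences as iterated sums *)

(** The membership condition of [Yset] with length and bounds decoupled, to allow induction on the
    first entry. *)
Definition monotone_from (N d lo : nat) (mu : {ffun 'I_d -> 'I_N.+1}) : bool :=
  [forall i : 'I_d, (lo <= mu i)%N] &&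
  [forall i : 'I_d, forall j : 'I_d, (i <= j)%N ==> (mu i <= mu j)%N].

Definition ffun_cons (T : Type) (d : nat) (x : T) (f : {ffun 'I_d -> T}) :
    {ffun 'I_d.+1 -> T} :=
  [ffun i => oapp f x (unlift ord0 i)].

Lemma ffun_cons0 (T : Type) (d : nat) (x : T) (f : {ffun 'I_d -> T}) :
  ffun_cons x f ord0 = x.
Proof. by rewrite ffunE unlift_none. Qed.

Lemma ffun_consS (T : Type) (d : nat) (x : T) (f : {ffun 'I_d -> T}) (i : 'I_d) :
  ffun_cons x f (lift ord0 i) = f i.
Proof. by rewrite ffunE liftK. Qed.

Lemma ffun_cons_bij (T : Type) (d : nat) :
  bijective (fun p : T * {ffun 'I_d -> T} => ffun_cons p.1 p.2).
Proof.
exists (fun h : {ffun 'I_d.+1 -> T} => (h ord0, [ffun i => h (lift ord0 i)])).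
  move=> [x f] /=; rewrite ffun_cons0; congr pair.
  by apply/ffunP => i; rewrite ffunE ffun_consS.
move=> h; apply/ffunP => i /=.
by case: (unliftP ord0 i) => [j|] ->; rewrite ?ffun_consS ?ffun_cons0 ?ffunE.
Qed.

Lemma monotone_from_cons (N d lo : nat) (x : 'I_N.+1) (f : {ffun 'I_d -> 'I_N.+1}) :
  monotone_from lo (ffun_cons x f) = (lo <= x)%N && monotone_from x f.
Proof.
apply/andP/andP => [[/forallP lof /forallP mf]|[lox /andP[/forallP xf /forallP mf]]].
  split; first by have := lof ord0; rewrite ffun_cons0.
  apply/andP; split; apply/forallP => i.
    by have /forallP/(_ (lift ord0 i)) := mf ord0; rewrite ffun_cons0 ffun_consS.
  apply/forallP => j.
  by have /forallP/(_ (lift ord0 j)) := mf (lift ord0 i); rewrite !ffun_consS.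
split; apply/forallP => i.
  case: (unliftP ord0 i) => [j|] ->; rewrite ?ffun_consS ?ffun_cons0 //.
  exact: leq_trans lox (xf j).
apply/forallP => j.
case: (unliftP ord0 i) => [i'|] ->; case: (unliftP ord0 j) => [j'|] ->;
  rewrite ?ffun_consS ?ffun_cons0 ?leqnn ?implybT //.
- exact: (forallP (mf i') j').
- exact: xf.
Qed.

Lemma sum_monotone_from (R : pzSemiRingType) (g : nat -> nat -> R) (N d lo off : nat) :
  \sum_(mu : {ffun 'I_d -> 'I_N.+1} | monotone_from lo mu)
    \prod_(i < d) g (i + off)%N (mu i) = monotone_sum g N d lo off.
Proof.
elim: d lo off => [|d IHd] lo off.
  rewrite (big_pred1 [ffun=> ord0]) ?big_ord0 // => mu.
  have -> : mu = [ffun=> ord0] by apply/ffunP => -[].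
  by rewrite [RHS]/= eqxx; apply/andP; split; apply/forallP => -[].
rewrite (reindex _ (onW_bij _ (@ffun_cons_bij _ d))) /=.
rewrite (eq_bigl _ _ (fun p => monotone_from_cons lo p.1 p.2)).
rewrite (eq_bigr (fun p : 'I_N.+1 * {ffun 'I_d -> 'I_N.+1} =>
  g off p.1 * \prod_(i < d) g (i + off.+1)%N (p.2 i))); last first.
  move=> p _; rewrite big_ord_recl ffun_cons0; congr (_ * _).
  by apply: eq_bigr => i _; rewrite ffun_consS lift0 addSnnS.
rewrite -(pair_big_dep (fun x : 'I_N.+1 => (lo <= x)%N)
  (fun (x : 'I_N.+1) (f : {ffun 'I_d -> 'I_N.+1}) => monotone_from x f)
  (fun (x : 'I_N.+1) f => g off x * \prod_(i < d) g (i + off.+1)%N (f i))) /=.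
rewrite (big_nat_widenl _ 0) // big_mkord; apply: eq_bigr => x _.
by rewrite -big_distrr IHd.
Qed.

(** * Domination criteria for series *)

Section SeriesFacts.
Local Open Scope classical_set_scope.
Variable R : realType.

Lemma normed_series_le_cvg (u v : R ^nat) :
  (forall n, `|u n| <= v n) -> cvgn (series v) -> cvgn [normed series u].
Proof.
by move=> uv; apply: series_le_cvg => n /=; rewrite ?(le_trans _ (uv n)).
Qed.

Lemma is_cvg_series_expr_mul (q : R) (u : R ^nat) : 0 < q -> q < 1 ->
  cvgn u -> cvgn (series (fun m => q ^+ m * u m)).
Proof.
move=> q_gt0 q_lt1 /cvg_seq_bounded/pinfty_ex_gt0[B _ uB].
apply/normed_cvg/(normed_series_le_cvg (v := geometric B q)); last first.
  by apply: is_cvg_geometric_series; rewrite gtr0_norm.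
move=> n; rewrite normrM normrX gtr0_norm // /geometric /= [leLHS]mulrC.
by apply: ler_wpM2r; [exact/exprn_ge0/ltW | exact: (uB n I)].
Qed.

End SeriesFacts.

(** * The Gaussian weight as a power series *)

Section GaussianWeight.
Local Open Scope classical_set_scope.
Variables (R : realType) (q : R).
Hypotheses (q_gt0 : 0 < q) (q_lt1 : q < 1).

Let qX_gt0 n : 0 < q ^+ n. Proof. exact: exprn_gt0. Qed.

Let oneBqX_gt0 n : 0 < 1 - q ^+ n.+1.
Proof. by rewrite subr_gt0 exprn_ilt1 // ltW. Qed.

(** Coefficients of w_G in the variable y = (1-q) x^2, which turns the grid point q^m nu into
    q^(2m). *)
Definition gauss_coef (m : nat) : R :=
  (-1) ^+ m * q ^+ (m * m.+1) / \prod_(0 <= i < m) (1 - q ^+ (2 * i + 2)).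

Lemma gauss_coef0 : gauss_coef 0 = 1.
Proof. by rewrite /gauss_coef big_geq // invr1 !mulr1. Qed.

Lemma gauss_coefS (m : nat) :
  (1 - q ^+ m.*2.+2) * gauss_coef m.+1 = - q ^+ m.*2.+2 * gauss_coef m.
Proof.
rewrite /gauss_coef big_nat_recr //= (_ : (2 * m + 2)%N = m.*2.+2); last by lia.
have p0 : \prod_(0 <= i < m) (1 - q ^+ (2 * i + 2)) != 0.
  rewrite prodf_seq_neq0; apply/allP => i _ /=.
  by rewrite addn2 gt_eqF.
have -> : (m.+1 * m.+2)%N = (m * m.+1 + m.*2.+2)%N by lia.
have q0 : 1 - q ^+ m.*2.+2 != 0 by rewrite gt_eqF.
by rewrite exprD [(-1) ^+ _]exprS; field; rewrite p0 q0.
Qed.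

(** In other words k q^k <= [k]_q, a sum of [k] powers that are each at least q^k. *)
Lemma mulrn_expr_le (k : nat) : k%:R * q ^+ k * (1 - q) <= 1 - q ^+ k.
Proof.
elim: k => [|k IH]; first by rewrite !mul0r expr0 subrr.
have h1 := ltW (oneBqX_gt0 k); have h2 : 0 <= (1 - q) * (1 - q ^+ k.+1).
  by rewrite mulr_ge0 // subr_ge0 ltW.
have := ler_wpM2l (ltW q_gt0) IH.
move: h2; rewrite -natr1 !exprS; set x := q ^+ k; set y := k%:R => h2 h3.
nra.
Qed.

(** The ratio of consecutive terms, q^(2m+2) / (1 - q^(2m+2)), is at most 1 / ((1-q)(m+1)), the
    ratio for the exponential series. *)
Lemma norm_gauss_coef_le (m : nat) : `|gauss_coef m| <= exp_coeff (1 - q)^-1 m.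
Proof.
have q1 : 0 < 1 - q by rewrite subr_gt0.
elim: m => [|m IH]; first by rewrite gauss_coef0 normr1 /exp_coeff /= divr1 expr0.
have pos := oneBqX_gt0 m.*2.+1.
have -> : gauss_coef m.+1 = - (q ^+ m.*2.+2 / (1 - q ^+ m.*2.+2) * gauss_coef m).
  apply: (mulfI (lt0r_neq0 pos)); rewrite gauss_coefS; field.
  by rewrite gt_eqF.
rewrite normrN normrM ger0_norm; last by rewrite divr_ge0 ?ltW.
have -> : exp_coeff (1 - q)^-1 m.+1 = ((1 - q)^-1 / m.+1%:R) * exp_coeff (1 - q)^-1 m.
  rewrite /exp_coeff /= factS natrM exprS; field.
  by rewrite gt_eqF ?ltr0n ?fact_gt0 //= nat1r pnatr_eq0 /= gt_eqF.
apply: ler_pM => //; first by rewrite divr_ge0 ?ltW.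
rewrite ler_pdivrMr // mulrAC ler_pdivlMr ?ltr0Sn // mulrC ler_pdivlMl //.
apply: le_trans (mulrn_expr_le _); rewrite [leLHS]mulrC ler_pM2r // ler_pM2r //.
by rewrite ler_nat; lia.
Qed.

Lemma is_cvg_gauss_normed (K : R) (u : R ^nat) :
  (forall m, `|u m| <= K * `|gauss_coef m|) -> cvgn [normed series u].
Proof.
move=> uK; apply: (@normed_series_le_cvg _ _ (K *: exp_coeff (1 - q)^-1)).
  move=> m; apply: le_trans (uK m) _.
  have K0 : 0 <= K.
    by have := le_trans (normr_ge0 _) (uK 0%N); rewrite gauss_coef0 normr1 mulr1.
  by rewrite ler_wpM2l // norm_gauss_coef_le.
exact/is_cvg_seriesZ/is_cvg_series_exp_coeff.
Qed.

Definition gauss_series (y : R) : R := limn (series (fun m => gauss_coef m * y ^+ m)).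

Lemma cvg_gauss_series (y : R) : `|y| <= 1 ->
  series (fun m => gauss_coef m * y ^+ m) @ \oo --> gauss_series y.
Proof.
move=> y1; apply/normed_cvg/(@is_cvg_gauss_normed 1) => m.
by rewrite normrM normrX mul1r ler_piMr // exprn_ile1.
Qed.

(** This is w(x/q) = (1 - (1-q) x^2) w(x) with y = (1-q) (x/q)^2, a consequence of the coefficient
    recursion. *)
Lemma gauss_series_qdiff (y : R) : `|y| <= 1 ->
  gauss_series y = (1 - q ^+ 2 * y) * gauss_series (q ^+ 2 * y).
Proof.
move=> y1; have qy1 : `|q ^+ 2 * y| <= 1.
  by rewrite normrM mulr_ile1 // normrX gtr0_norm // exprn_ile1 // ltW.
(* The identity is already exact on partial sums, the last one lagging by a term because of the
   extra factor [y]. *)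
have E n : series (fun m => gauss_coef m * y ^+ m) n.+1 =
    series (fun m => gauss_coef m * (q ^+ 2 * y) ^+ m) n.+1 -
    q ^+ 2 * y * series (fun m => gauss_coef m * (q ^+ 2 * y) ^+ m) n.
  elim: n => [|n IH].
    by rewrite !seriesSr /series /= !big_geq // mulr0 subr0.
  rewrite seriesSr IH [in RHS]seriesSr [X in _ = _ - _ * X]seriesSr.
  have := gauss_coefS n; rewrite -mul2n.
   have qyE k : (q ^+ 2 * y) ^+ k = q ^+ (2 * k) * y ^+ k by rewrite exprMn exprM.
  rewrite !qyE (_ : (2 * n).+2 = (2 * n.+1)%N); last by lia.
  move=> H; rewrite (_ : gauss_coef n.+1 * y ^+ n.+1 =
    (1 - q ^+ (2 * n.+1)) * gauss_coef n.+1 * y ^+ n.+1 +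
    gauss_coef n.+1 * (q ^+ (2 * n.+1) * y ^+ n.+1)); last by ring.
  rewrite H (_ : (2 * n.+1)%N = (2 * n).+2); last by lia.
  by rewrite !exprS; ring.
have := cvg_gauss_series y1; rewrite -cvg_shiftS => c1.
have c2 := cvg_gauss_series qy1.
have := c2; rewrite -cvg_shiftS => c3.
apply: (cvg_unique _ c1) => //.
rewrite (funext E) mulrBl mul1r; apply: cvgB => //.
apply: cvgM => //; exact: cvg_cst.
Qed.

Lemma gauss_series_near1 (y : R) : `|y| <= 1 ->
  `|gauss_series y - 1| <= limn [normed series gauss_coef] * `|y|.
Proof.
move=> y1; have cN : cvgn [normed series gauss_coef].
  by apply: (@is_cvg_gauss_normed 1) => m; rewrite mul1r.
have E n : `|series (fun m => gauss_coef m * y ^+ m) n.+1 - 1| <=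
    [normed series gauss_coef] n.+1 * `|y|.
  elim: n => [|n IH].
    rewrite seriesSr /series /= !big_geq // add0r expr0 gauss_coef0 mulr1 subrr normr0.
    by rewrite mulr_ge0 // sumr_ge0.
  rewrite seriesSr [X in _ <= X * _]seriesSr addrAC mulrDl.
  apply: le_trans (ler_normD _ _) _; apply: lerD => //.
  by rewrite normrM ler_wpM2l // normrX exprS ler_piMr // exprn_ile1.
have c1 : (fun n => `|series (fun m => gauss_coef m * y ^+ m) n.+1 - 1|)
    @ \oo --> `|gauss_series y - 1|.
  apply: cvg_norm; apply: cvgB; last exact: cvg_cst.
  by rewrite cvg_shiftS; exact: cvg_gauss_series.
have c2 : (fun n => [normed series gauss_coef] n.+1 * `|y|) @ \oo -->
    limn [normed series gauss_coef] * `|y|.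
  by apply: cvgM; [rewrite cvg_shiftS | exact: cvg_cst].
by apply: (ler_cvg_to c1 c2); apply: nearW.
Qed.

(** The q^2-factorial contributes (1-q^2)^m, of which [2]_q^m = (1+q)^m cancels all but (1-q)^m. *)
Lemma wGE (x : R) : wG q x = gauss_series ((1 - q) * x ^+ 2).
Proof.
rewrite /wG /qExp /gauss_series; congr (limn (series _)); apply/funext => m.
have q1 : 1 - q != 0 by rewrite subr_eq0 gt_eqF.
have q1' : 1 + q != 0 by rewrite gt_eqF // addr_gt0.
have -> : qfact (q ^+ 2) m =
    (\prod_(0 <= i < m) (1 - q ^+ (2 * i + 2))) / ((1 - q) * (1 + q)) ^+ m.
  elim: m => [|m IH]; first by rewrite /qfact !big_geq // expr0 divr1.
  rewrite /qfact big_nat_recr //= -/(qfact _ _) IH big_nat_recr //= /qint.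
  rewrite -!exprnP -exprM (_ : (2 * m + 2)%N = (2 * m.+1)%N); last by lia.
  have -> : 1 - q ^+ 2 = (1 - q) * (1 + q) by ring.
  rewrite [(_ * _) ^+ m.+1]exprS; set X := _ ^+ m; set P := \prod_(_ <= _ < _) _.
  have X0 : X != 0 by rewrite expf_neq0 // mulf_neq0.
  by field; rewrite X0 q1 q1'.
have -> : q ^+ 2 * x ^+ 2 / qint q 2 = q ^+ 2 * x ^+ 2 / (1 + q).
  by rewrite /qint -exprnP; field; rewrite q1 q1' gt_eqF ?(oneBqX_gt0 1).
rewrite /gauss_coef.
have -> : (m * m.+1)%N = (2 * 'C(m, 2) + 2 * m)%N.
  by elim: (m) => [|k IH] //; rewrite binS bin1; lia.
have p0 : \prod_(0 <= i < m) (1 - q ^+ (2 * i + 2)) != 0.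
  by rewrite prodf_seq_neq0; apply/allP => i _ /=; rewrite addn2 gt_eqF.
rewrite exprD !exprM -[- (_ / _)]mulN1r; move: (x ^+ 2) (q ^+ 2) => u v.
rewrite !exprMn exprVn; field.
by rewrite p0 !expf_neq0.
Qed.

End GaussianWeight.

(** * Jackson moments against the Gaussian weight *)

Section JacksonMoments.
Local Open Scope classical_set_scope.
Variables (R : realType) (q : R).
Hypotheses (q_gt0 : 0 < q) (q_lt1 : q < 1).

Let qX_gt0 n : 0 < q ^+ n. Proof. exact: exprn_gt0. Qed.

Let qX_le1 n : q ^+ n <= 1. Proof. by rewrite exprn_ile1 // ltW. Qed.

Let cvg_qX : (fun m => q ^+ m) @ \oo --> (0 : R).
Proof. by apply: cvg_expr; rewrite gtr0_norm. Qed.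

Definition gauss_grid (m : nat) : R := gauss_series q (q ^+ (2 * m)).

Lemma gauss_gridS (m : nat) :
  gauss_grid m = (1 - q ^+ (2 * m.+1)) * gauss_grid m.+1.
Proof.
rewrite /gauss_grid (gauss_series_qdiff q_gt0 q_lt1); last first.
  by rewrite ger0_norm // ltW.
by rewrite -exprD (_ : (2 + 2 * m)%N = (2 * m.+1)%N) //; lia.
Qed.

Lemma cvg_gauss_grid : gauss_grid @ \oo --> (1 : R).
Proof.
apply/subr_cvg0/norm_cvg0P.
set A := limn [normed series (gauss_coef q)].
have cA : (fun m => A * q ^+ m) @ \oo --> (0 : R).
  by rewrite -(mulr0 A); apply: cvgM => //; exact: cvg_cst.
apply: (squeeze_cvgr _ (cvg_cst 0) cA); apply: nearW => m.
rewrite normr_ge0 /=.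
have y1 : `|q ^+ (2 * m)| <= 1 by rewrite ger0_norm // ltW.
apply: le_trans (gauss_series_near1 q_gt0 q_lt1 y1) _.
rewrite (ger0_norm (ltW (qX_gt0 _))); apply: ler_wpM2l.
  apply: limr_ge; last first.
    by apply: nearW => n /=; apply: sumr_ge0 => i _; exact: normr_ge0.
  by apply: (is_cvg_gauss_normed q_gt0 q_lt1 (K := 1)) => n; rewrite mul1r.
by rewrite mul2n -addnn exprD ler_piMl // ltW.
Qed.

(** The values tend to 1, hence are eventually positive; [gauss_gridS] carries positivity back to
    smaller indices. *)
Lemma gauss_grid_gt0 (m : nat) : 0 < gauss_grid m.
Proof.
have [K _ KP] : \forall k \near \oo, 0 < gauss_grid k.
  by apply: (cvgr_gt _ cvg_gauss_grid); exact: ltr01.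
suff H d k : (K <= k + d)%N -> 0 < gauss_grid k by apply: (H K); exact: leq_addl.
elim: d k => [|d IH] k; first by rewrite addn0; exact: KP.
rewrite addnS -addSn => /IH pos; rewrite gauss_gridS mulr_gt0 // subr_gt0.
by rewrite exprn_ilt1 // ltW.
Qed.

Lemma wG_grid (b : R) (m : nat) : (1 - q) * b ^+ 2 = 1 ->
  wG q (q ^+ m * b) = gauss_grid m.
Proof.
move=> b2; rewrite wGE // /gauss_grid; congr (gauss_series q _).
by rewrite exprMn mulrCA b2 mulr1 -exprM mulnC.
Qed.

(** Used under (1-q) b^2 = 1, which treats the endpoints nu and -nu at once. *)
Definition grid_moment (b : R) (p : {poly R}) : R :=
  jackson0 q (fun x => p.[x] * wG q x) b.

Lemma cvg_horner_grid (b : R) (p : {poly R}) :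
  (fun m => p.[q ^+ m * b]) @ \oo --> p.[0].
Proof.
have cb : (fun m => q ^+ m * b) @ \oo --> (0 : R).
  by rewrite -(mul0r b); apply: cvgM => //; exact: cvg_cst.
apply: (@continuous_cvg _ _ _ _ _ (fun m => q ^+ m * b) (horner p) 0 _ cb).
exact: continuous_horner.
Qed.

Lemma is_cvg_grid_moment (b : R) (p : {poly R}) : (1 - q) * b ^+ 2 = 1 ->
  cvgn (series (fun m => q ^+ m * (p.[q ^+ m * b] * wG q (q ^+ m * b)))).
Proof.
move=> b2; apply: is_cvg_series_expr_mul => //; apply/cvg_ex; exists (p.[0] * 1).
under eq_fun do rewrite wG_grid //.
by apply: cvgM; [exact: cvg_horner_grid | exact: cvg_gauss_grid].
Qed.

Arguments is_cvg_grid_moment [b] p.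

Lemma grid_moment_is_linear (b : R) : (1 - q) * b ^+ 2 = 1 ->
  forall (a : R) (p r : {poly R}),
  grid_moment b (a *: p + r) = a * grid_moment b p + grid_moment b r.
Proof.
move=> b2 a p r; rewrite /grid_moment /jackson0 mulrCA -mulrDr; congr (_ * _).
have cp := is_cvg_grid_moment p b2; have cr := is_cvg_grid_moment r b2.
rewrite -[a * _](lim_seriesZ a cp) -lim_seriesD //; last exact: is_cvg_seriesZ.
congr (limn (series _)); apply/funext => m.
by rewrite !fctE hornerD hornerZ /GRing.scale /=; ring.
Qed.

(* The polynomial form of D_q [p(x) w(x/q)] = (D_q p - x p) w: the sum
   telescopes, and the boundary term at b vanishes since w(b/q) = 0. *)
Lemma grid_moment_qdiff (b : R) (p r : {poly R}) : (1 - q) * b ^+ 2 = 1 ->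
  (forall x, p.[x] - p.[q * x] = (1 - q) * x * r.[x]) ->
  grid_moment b ('X * p) = grid_moment b r + p.[0].
Proof.
move=> b2 pr.
have c1 := is_cvg_grid_moment ('X * p) b2; have c2 := is_cvg_grid_moment r b2.
apply: (addrI (- grid_moment b r)); rewrite addKr addrC /grid_moment /jackson0.
rewrite -mulrBr -lim_seriesB //.
(* This is p(x) w(x/q) at x = q^m b; the factor 1 - q^(2m) makes it vanish at [m = 0]. *)
pose v m := p.[q ^+ m * b] * (1 - q ^+ (2 * m)) * gauss_grid m.
have cv : v @ \oo --> p.[0].
  rewrite -[p.[0]]mulr1; apply: cvgM; last exact: cvg_gauss_grid.
  rewrite -[p.[0]]mulr1; apply: cvgM; first exact: cvg_horner_grid.
  rewrite -[X in _ --> X](subr0 1); apply: cvgB; first exact: cvg_cst.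
  rewrite (_ : (fun m => q ^+ (2 * m)) = (fun m => q ^+ m * q ^+ m)); last first.
    by apply/funext => m; rewrite mul2n -addnn exprD.
  by rewrite -(mulr0 0); apply: cvgM.
have qb0 : (1 - q) * b != 0.
  apply/eqP => E; move: b2; rewrite expr2 mulrA E mul0r => /esym/eqP.
  by rewrite oner_eq0.
set f := (X in limn (series X)).
have -> : f = ((1 - q) * b)^-1 *: telescope v.
  apply/funext => m; apply: (mulfI qb0); rewrite /f !fctE /GRing.scale /= mulVKf //.
  rewrite !wG_grid // /telescope /v /= hornerM hornerX (gauss_gridS m).
  have := pr (q ^+ m * b); rewrite [q * _]mulrA -exprS => E.
  have -> : p.[q ^+ m.+1 * b] =
      p.[q ^+ m * b] - (1 - q) * (q ^+ m * b) * r.[q ^+ m * b].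
    by rewrite -E; ring.
  have -> : q ^+ (2 * m) = (1 - q) * b ^+ 2 * q ^+ m * q ^+ m.
    by rewrite b2 mul1r -exprD addnn mul2n.
  ring.
have cv0 : series (telescope v) @ \oo --> p.[0].
  rewrite telescopeK -[X in _ --> X]subr0; apply: cvgB => //.
  rewrite (_ : v 0%N = 0); first exact: cvg_cst.
  by rewrite /v expr0 subrr mulr0 mul0r.
rewrite lim_seriesZ; last by apply: cvgP; exact: cv0.
by rewrite (cvg_lim _ cv0) // /GRing.scale /= mulVKf.
Qed.

Definition gauss_int_coef (m : nat) : R := gauss_coef q m / (1 - q ^+ (2 * m + 1)).

(** Termwise integration by telescoping instead of exchanging sums: [T k] is the candidate for the
    tail from [k], with each geometric sum of q^(j(2m+1)) over j >= k already evaluated. Its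
    differences are the summands, and it tends to 0. *)
Lemma sum_gauss_grid :
  series (fun k => q ^+ k * gauss_grid k) @ \oo --> limn (series gauss_int_coef).
Proof.
have den_gt0 m : 0 < 1 - q ^+ (2 * m + 1).
  by rewrite subr_gt0 exprn_ilt1 ?addn1 // ltW.
have q1 : 0 < 1 - q by rewrite subr_gt0.
have bound k m : `|gauss_int_coef m * q ^+ (k * (2 * m))| <=
    (1 - q)^-1 * `|gauss_coef q m|.
  rewrite normrM normrX (gtr0_norm q_gt0) mulrC.
  apply: le_trans (ler_piMl _ (qX_le1 _)) _ => //.
  rewrite /gauss_int_coef normrM normfV (gtr0_norm (den_gt0 m)) mulrC.
  rewrite ler_wpM2r // lef_pV2 ?posrE // lerD2l lerN2 addn1 exprS.
  by rewrite ler_piMr // ltW.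
pose t k m := gauss_int_coef m * q ^+ (k * (2 * m)).
have ct k : cvgn [normed series (t k)].
  exact: (is_cvg_gauss_normed q_gt0 q_lt1 (bound k)).
pose T k := q ^+ k * limn (series (t k)).
have T0 : T 0%N = limn (series gauss_int_coef).
  rewrite /T expr0 mul1r; congr (limn (series _)); apply/funext => m.
  by rewrite /t mul0n expr0 mulr1.
have cT : T @ \oo --> (0 : R).
  apply/norm_cvg0P; set B := limn (series ((1 - q)^-1 *: (fun m => `|gauss_coef q m|))).
  have cB : (fun k => q ^+ k * B) @ \oo --> (0 : R).
    by rewrite -(mul0r B); apply: cvgM => //; exact: cvg_cst.
  apply: (squeeze_cvgr _ (cvg_cst 0) cB); apply: nearW => k.
  rewrite normr_ge0 /= /T normrM (gtr0_norm (qX_gt0 k)) ler_pM2l //.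
  apply: le_trans (lim_series_norm (ct k)) _.
  apply: lim_series_le; [exact: ct | | exact: bound].
  apply: is_cvg_seriesZ; apply: (is_cvg_gauss_normed q_gt0 q_lt1 (K := 1)) => m.
  by rewrite mul1r.
have step k : q ^+ k * gauss_grid k = - telescope T k.
  rewrite /telescope opprB /T.
  rewrite -[q ^+ k * limn (series (t k))](lim_seriesZ _ (normed_cvg (ct k))).
  rewrite -[q ^+ k.+1 * limn (series (t k.+1))](lim_seriesZ _ (normed_cvg (ct k.+1))).
  rewrite -lim_seriesB; [|exact/is_cvg_seriesZ/normed_cvg..].
  have cg : cvgn (series (fun m => gauss_coef q m * (q ^+ (2 * k)) ^+ m)).
    by apply/cvgP/(cvg_gauss_series q_gt0 q_lt1); rewrite ger0_norm // ltW.
  rewrite /gauss_grid /gauss_series -[LHS](lim_seriesZ (q ^+ k) cg).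
  congr (limn (series _)); apply/funext => m.
  rewrite !fctE /GRing.scale /= /t /gauss_int_coef.
  have -> : (k.+1 * (2 * m))%N = (k * (2 * m) + 2 * m)%N by lia.
  rewrite -exprM (_ : (2 * k * m)%N = (k * (2 * m))%N); last by lia.
  have := lt0r_neq0 (den_gt0 m); rewrite addn1 [q ^+ (2 * m).+1]exprS.
  rewrite [q ^+ k.+1]exprS exprD; move: (q ^+ (2 * m)) => a d0; field.
  exact: d0.
rewrite (funext step) -T0 (_ : (fun k => - telescope T k) = - telescope T) //.
rewrite seriesN telescopeK (_ : (- _) = (fun n => T 0%N - T n)); last first.
  by apply/funext => n; rewrite !fctE opprB.
by rewrite -[X in _ --> X]subr0; apply: cvgB => //; exact: cvg_cst.
Qed.

Definition moment (p : {poly R}) : R := grid_moment (nu q) p - grid_moment (- nu q) p.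

Let nu2 : (1 - q) * nu q ^+ 2 = 1.
Proof.
have q1 : 0 < 1 - q by rewrite subr_gt0.
by rewrite /nu div1r exprVn sqr_sqrtr ?mulfV ?gt_eqF // ltW.
Qed.

Let nuN2 : (1 - q) * (- nu q) ^+ 2 = 1.
Proof. by rewrite sqrrN. Qed.

Lemma moment_is_linear : scalar moment.
Proof.
move=> a p r; rewrite /moment !grid_moment_is_linear //; ring.
Qed.

(** The boundary term [p.[0]] is the same at both endpoints and cancels. *)
Lemma moment_qdiff (p r : {poly R}) :
  (forall x, p.[x] - p.[q * x] = (1 - q) * x * r.[x]) ->
  moment ('X * p) = moment r.
Proof.
by move=> pr; rewrite /moment !(grid_moment_qdiff _ pr) // opprD addrACA subrr addr0.
Qed.

Lemma cG_sum : cG q = 2 * Num.sqrt (1 - q) * limn (series gauss_int_coef).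
Proof.
rewrite /cG; congr (_ * _); congr (limn (series _)); apply/funext => m.
by rewrite /gauss_int_coef /gauss_coef [(1 - _) * _]mulrC invfM mulrA.
Qed.

Lemma moment1 : moment 1 = cG q.
Proof.
have q1 : 0 < 1 - q by rewrite subr_gt0.
have E b : (1 - q) * b ^+ 2 = 1 ->
    grid_moment b 1 = (1 - q) * b * limn (series gauss_int_coef).
  move=> b2; rewrite /grid_moment /jackson0 -(cvg_lim _ sum_gauss_grid) //.
  congr (_ * _); congr (limn (series _)); apply/funext => k.
  by rewrite hornerC mul1r wG_grid.
rewrite /moment !E // cG_sum.
have -> : Num.sqrt (1 - q) = (1 - q) * nu q.
  have s0 : Num.sqrt (1 - q) != 0 by rewrite gt_eqF // sqrtr_gt0.
  by rewrite /nu -{2}[1 - q]sqr_sqrtr ?ltW // div1r expr2 mulfK.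
ring.
Qed.

(** The alternating series hides the sign; its other form, from [sum_gauss_grid], has positive terms
    and so dominates its first one. *)
Lemma cG_gt0 : 0 < cG q.
Proof.
rewrite cG_sum !mulr_gt0 ?sqrtr_gt0 ?subr_gt0 //.
apply: lt_le_trans (gauss_grid_gt0 0) _.
rewrite -(cvg_lim _ sum_gauss_grid) //; apply: limr_ge.
  exact/cvgP/sum_gauss_grid.
exists 1%N => // -[|n] // _.
rewrite seriesEnat /= big_nat_recl // expr0 mul1r lerDl sumr_ge0 // => i _.
by rewrite mulr_ge0 // ltW // gauss_grid_gt0.
Qed.

End JacksonMoments.

(** * From weighted paths to the normalised sum over [Yset] *)

Lemma qweight_prodE (R : realType) (q : R) (n : nat) :
  qweight_prod q n = q ^+ 'C(n, 2) * qfact q n.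
Proof.
elim: n => [|n IH]; first by rewrite /qweight_prod /qfact !big_geq // mulr1.
rewrite qweight_prodS IH /qfact [in RHS]big_nat_recr //= binS bin1 exprD /qweight /=.
ring.
Qed.

(* At [x = i] the power of [q] has exponent [-1], but the factor [[0]_q] kills it. *)
Lemma qweight_int (R : realType) (q : R) (i x : nat) : (i <= x)%N ->
  q ^ (x%:Z - i.+1%:Z) * qint q (x%:Z - i.+1%:Z + 1) = qweight q (x - i).
Proof.
move=> le_ix; have -> : x%:Z - i.+1%:Z + 1 = (x - i)%N%:Z by lia.
rewrite /qweight; case: (posnP (x - i)) => [->|pos]; first by rewrite qint0 !mulr0.
by have -> : x%:Z - i.+1%:Z = (x - i).-1%:Z by lia.
Qed.

Theorem theorem4p15 (R : realType) (q : R) (q_gt0 : 0 < q) (q_lt1 : q < 1)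
    (n s : nat) :
  1 / (q ^+ 'C(s, 2) * qfact q s * cG q) *
    jackson q (fun x : R => x ^+ (2 * n) * (qHermite q s).[x] ^+ 2 * wG q x)
      (- nu q) (nu q) =
  \sum_(mu in Yset n s)
    \prod_(i < n) (q ^ ((mu i)%:Z - (i.+1)%:Z) *
                   qint q ((mu i)%:Z - (i.+1)%:Z + 1)).
Proof.
pose lin := GRing.isLinear.Build _ _ _ _ _ (moment_is_linear q_gt0 q_lt1).
pose M : {scalar {poly R}} := HB.pack (moment q) lin.
pose g (i x : nat) := q ^ (x%:Z - i.+1%:Z) * qint q (x%:Z - i.+1%:Z + 1).
(* Paths with [n] up and [n] down steps from height [s] back to [s]; hence the bound [n + s] on the
   entries. *)
have dyck := @moment_dyck R q (negbT (lt_eqF q_lt1)) M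
  (moment_qdiff q_gt0 q_lt1) g (qweight_int q) (n + s) n n s 0 s isT.
rewrite subn0 addn0 [in X in X = _ -> _]addnC in dyck.
have -> : jackson q (fun x => x ^+ (2 * n) * (qHermite q s).[x] ^+ 2 * wG q x)
    (- nu q) (nu q) = M ('X^(n + n) * (qHermite q s * qHermite q s)).
  rewrite /M /= /moment /grid_moment /jackson.
  by congr (jackson0 _ _ _ - jackson0 _ _ _); apply/funext => x;
    rewrite !hornerM hornerXn addnn mul2n expr2.
rewrite dyck //; last by rewrite addnC.
rewrite (_ : M 1 = cG q); last exact: moment1.
rewrite qweight_prodE.
have lam0 : q ^+ 'C(s, 2) * qfact q s != 0.
  rewrite gt_eqF // mulr_gt0 ?exprn_gt0 // /qfact big_add1 prodr_gt0 // => i _.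
  by rewrite /qint divr_gt0 ?subr_gt0 // exprn_ilt1 // ltW.
have c0 : cG q != 0 by rewrite gt_eqF // cG_gt0.
rewrite div1r mulrC mulfK; last exact: mulf_neq0 lam0 c0.
rewrite -sum_monotone_from.
apply: eq_big => [mu|mu _]; first by rewrite inE.
by apply: eq_bigr => i _; rewrite addn0.
Qed.
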